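(* Let $G$ be a finite simple connected graph and let $G'$ be obtained from $G$ by iteratively appending new blocks, each of which is a $K_2$. Then $Aux(G')=Aux(G)$ (up to isomorphism).
   Context: For a finite simple connected graph $G$ on $n$ vertices, the spanning tree auxiliary graph $Aux(G)$ is the graph whose vertices are the spanning trees of $G$, two spanning trees being adjacent if and only if one is obtained from the other by a single unit transformation, i.e. by adding one edge of $G$ not in the tree and deleting a different edge so that the result is again a spanning tree; equivalently, the symmetric difference of their edge sets has exactly two edges (they share exactly $n-2$ of their $n-1$ edges). A block of a graph is a maximal 2-connected subgraph, where a graph is 2-connected if it cannot be disconnected by deleting fewer than two vertices ($K_2$ counts as 2-connected). Appending a new block $K_2$ to a graph means adding one new vertex together with one edge joining it to an existing vertex. *)

(* Defs.v *)
From mathcomp Require Import all_boot.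
Set Implicit Arguments.
Unset Strict Implicit.
Unset Printing Implicit Defensive.

Record sgraph := SGraph {
  svertex :> finType;
  sedge : rel svertex;
  sedge_sym : symmetric sedge;
  sedge_irr : irreflexive sedge }.

Notation "x -- y" := (sedge x y) (at level 30).

Definition sgraph_iso (G H : sgraph) : Prop :=
  exists2 f : G -> H, bijective f & forall x y : G, f x -- f y = x -- y.

Definition connected_rel (V : finType) (e : rel V) : bool :=
  [forall x, forall y, connect e x y].

(* Cycle lengths are bounded by #|V| only to make the predicate boolean (see
   [acyclic_relP]); lengths 1 and 2 are excluded because walking an edge back
   and forth is a [cycle] in the sense of path.v. *)
Definition acyclic_rel (V : finType) (e : rel V) : bool :=
  [forall k : 'I_#|V|.+1, forall c : k.-tuple V,
     ~~ [&& 2 < k, cycle e c & uniq c]].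

Lemma acyclic_relP (V : finType) (e : rel V) :
  reflect (forall c : seq V, 2 < size c -> uniq c -> ~~ cycle e c)
          (acyclic_rel e).
Proof.
apply: (iffP forallP) => [H c c2 Uc | H k].
  have ltc : size c < #|V|.+1 by rewrite ltnS -(card_uniqP Uc) max_card.
  have /forallP/(_ (in_tuple c)) := H (Ordinal ltc).
  by rewrite /= c2 Uc andbT.
apply/forallP => c; apply/negP => /and3P[k2 Cc Uc].
by move: (H c); rewrite size_tuple k2 Uc Cc => /(_ isT isT).
Qed.

Definition connected (G : sgraph) : bool := connected_rel (@sedge G).

Definition edges (G : sgraph) : {set {set G}} :=
  [set e | [exists x : G, exists y : G, (x -- y) && (e == [set x; y])]].

(* A spanning tree is encoded by its edge set, its vertex set being that of G. *)
Definition spanning_tree (G : sgraph) (T : {set {set G}}) : bool :=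
  let adj := fun x y : G => [set x; y] \in T in
  [&& T \subset edges G, connected_rel adj & acyclic_rel adj].

Definition sptree (G : sgraph) := {T : {set {set G}} | spanning_tree T}.

Definition unit_transformation (G : sgraph) (T T' : sptree G) : bool :=
  [exists e in edges G :\: val T, exists f in val T,
     val T' == (e |: val T) :\ f].

Lemma unit_transformation_sym (G : sgraph) :
  symmetric (@unit_transformation G).
Proof.
suff H (T T' : sptree G) :
  unit_transformation T T' -> unit_transformation T' T.
  by move=> T T'; apply/idP/idP; exact: H.
case/exists_inP => e /setDP[eG eT] /exists_inP[f fT /eqP defT'].
have /subsetP TG : val T \subset edges G by have /and3P[] := valP T.
have nef : e != f by apply: contraNneq eT => ->.
apply/exists_inP; exists f; first by rewrite in_setD defT' setD11 TG.
apply/exists_inP; exists e; first by rewrite defT' !inE nef eqxx.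
by rewrite defT' setD1K ?setU1K // !inE fT orbT.
Qed.

Lemma unit_transformation_irr (G : sgraph) :
  irreflexive (@unit_transformation G).
Proof.
move=> T; apply/exists_inP => -[e /setDP[_ eT] /exists_inP[f fT /eqP defT]].
by move: eT; rewrite defT !inE eqxx andbT negbK => /eqP def_e; move: fT;
   rewrite defT !inE def_e eqxx.
Qed.

Definition Aux (G : sgraph) : sgraph :=
  @SGraph (sptree G) (@unit_transformation G)
    (@unit_transformation_sym G) (@unit_transformation_irr G).

(* [None] is the new vertex, joined to [v] only. *)
Definition append_edge (G : sgraph) (v : G) (a b : option G) : bool :=
  match a, b with
  | Some x, Some y => x -- y
  | Some x, None | None, Some x => x == v
  | None, None => false
  end.

Lemma append_edge_sym (G : sgraph) (v : G) : symmetric (append_edge v).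
Proof. by move=> [x|] [y|] //=; exact: sedge_sym. Qed.

Lemma append_edge_irr (G : sgraph) (v : G) : irreflexive (append_edge v).
Proof. by move=> [x|] //=; exact: sedge_irr. Qed.

Definition append_K2 (G : sgraph) (v : G) : sgraph :=
  @SGraph (option G) (append_edge v) (append_edge_sym v) (append_edge_irr v).

Inductive iter_append_K2 (G : sgraph) : sgraph -> Prop :=
| iter_append_K2_base (G' : sgraph) :
    sgraph_iso G' G -> iter_append_K2 G G'
| iter_append_K2_step (H G' : sgraph) (v : H) :
    iter_append_K2 G H -> sgraph_iso G' (append_K2 v) -> iter_append_K2 G G'.

(* Main.v *)
Require Import Defs.
From mathcomp Require Import all_boot.

(** A pendant edge belongs to every spanning tree, because it is the only way
to reach its leaf, and it lies on no cycle.  So adding the pendant edge is a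
bijection from the spanning trees of [G] to those of [append_K2 v], with
deletion as its inverse.  Two spanning trees are related by a unit
transformation exactly when each has a single edge outside the other
([unit_transformationE]), and an edge added to both sides changes neither
difference; hence the bijection is an isomorphism of auxiliary graphs
([Aux_append_K2]).  Auxiliary graphs of isomorphic graphs are isomorphic
([Aux_sgraph_iso]), and the theorem follows by induction on the number of
appended blocks.

Both facts are instances of [Aux_extension]: [G] embeds in [H] by [f], the
edges of [H] outside the image form a set [K] contained in every spanning tree
of [H], and [T |-> K :|: f(T)] preserves and reflects being a tree.  An
isomorphism is the case where [K] is empty. *)

Set Implicit Arguments.
Unset Strict Implicit.
Unset Printing Implicit Defensive.

(** * Isomorphisms of graphs *)

Lemma sgraph_iso_sym (G H : sgraph) : sgraph_iso G H -> sgraph_iso H G.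
Proof.
case=> f [g fK gK] f_edge; exists g => [|x y]; first by exists f.
by rewrite -f_edge !gK.
Qed.

Lemma sgraph_iso_trans (G H K : sgraph) :
  sgraph_iso G H -> sgraph_iso H K -> sgraph_iso G K.
Proof.
case=> f f_bij f_edge [g g_bij g_edge]; exists (g \o f); first exact: bij_comp.
by move=> x y; rewrite /= g_edge f_edge.
Qed.

(** * Connectedness and acyclicity along an embedding *)

Lemma connect_homo (V W : finType) (e : rel V) (e' : rel W) (h : V -> W) :
  (forall x y, e x y -> connect e' (h x) (h y)) ->
  forall x y, connect e x y -> connect e' (h x) (h y).
Proof.
move=> he x y /connectP[p]; elim: p x => [|z p IHp] x /= => [_ -> //|].
by case/andP=> /he xz /IHp zy /zy; apply: connect_trans.
Qed.

(** Connectedness descends along the retraction [r] and ascends along [f],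
since every vertex [a] is joined in both directions to the vertex [f (r a)] of
the image. *)
Lemma connected_rel_retract (V W : finType) (e : rel V) (e' : rel W)
    (f : V -> W) (r : W -> V) :
    cancel f r -> (forall x y, e x y -> e' (f x) (f y)) ->
    (forall a b, e' a b -> connect e (r a) (r b)) ->
    (forall a, connect e' a (f (r a)) && connect e' (f (r a)) a) ->
  connected_rel e' = connected_rel e.
Proof.
move=> fK fe re fr; apply/forallP/forallP => [conn x | conn a].
  apply/forallP => y; rewrite -[x]fK -[y]fK.
  by apply: (connect_homo re); have /forallP := conn (f x).
apply/forallP => b.
have [/andP[a_fra _] /andP[_ frb_b]] := (fr a, fr b).
apply: connect_trans a_fra (connect_trans _ frb_b).
apply: (connect_homo (e := e)) => [x y /fe|]; first exact: connect1.
by have /forallP := conn (r a).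
Qed.

Lemma acyclic_rel_embed (V W : finType) (e : rel V) (e' : rel W) (f : V -> W) :
    injective f -> (forall x y, e' (f x) (f y) = e x y) ->
    (forall c, 2 < size c -> uniq c -> cycle e' c -> {subset c <= codom f}) ->
  acyclic_rel e' = acyclic_rel e.
Proof.
move=> f_inj fe c_im.
have cycle_f c : cycle e' (map f c) = cycle e c.
  by rewrite cycle_map; apply: eq_cycle => x y; exact: fe.
apply/acyclic_relP/acyclic_relP => acyc c c2 Uc.
  by rewrite -cycle_f acyc ?size_map ?map_inj_uniq.
apply/negP => Cc; have c_f := c_im c c2 Uc Cc.
have [c0 def_c] : exists c0, c = map f c0.
  elim: c c_f {c2 Uc Cc} => [|a c IHc] c_f; first by exists [::].
  have /codomP[x ->] : a \in codom f by rewrite c_f ?mem_head.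
  have [|c0 ->] := IHc; last by exists (x :: c0).
  by move=> b cb; rewrite c_f // in_cons cb orbT.
move: c2 Uc Cc; rewrite def_c size_map map_inj_uniq // cycle_f => c2 Uc.
exact/negP/acyc.
Qed.

(** A vertex whose only neighbour is [v] lies on no cycle: its predecessor and
its successor would both be [v]. *)
Lemma pendant_notin_cycle (V : eqType) (e : rel V) (a v : V) (c : seq V) :
    (forall b, e a b -> b = v) -> (forall b, e b a -> b = v) ->
  2 < size c -> uniq c -> cycle e c -> a \notin c.
Proof.
move=> av va c2 Uc Cc; apply/negP => /rot_to[i p def_p].
have: 2 < size (a :: p) by rewrite -def_p size_rot.
have: uniq (a :: p) by rewrite -def_p rot_uniq.
have: cycle e (a :: p) by rewrite -def_p rot_cycle.
case: p {def_p} => [|b p] //=; rewrite rcons_path.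
case/and3P=> /av -> _ /va; case/lastP: p => // p z.
by rewrite last_rcons => ->; rewrite mem_rcons mem_head andbF.
Qed.

(** * Spanning trees along an embedding *)

Definition tree_adj (G : sgraph) (T : {set {set G}}) : rel G :=
  fun x y => [set x; y] \in T.

Lemma tree_adj_sym (G : sgraph) (T : {set {set G}}) : symmetric (tree_adj T).
Proof. by move=> x y; rewrite /tree_adj setUC. Qed.

Lemma spanning_tree_sub (G : sgraph) (T : {set {set G}}) :
  spanning_tree T -> T \subset edges G.
Proof. by case/and3P. Qed.

Lemma mem_edges2 (G : sgraph) (x y : G) : ([set x; y] \in edges G) = x -- y.
Proof.
rewrite inE; apply/existsP/idP => [[a /existsP[b /andP[ab /eqP E]]]|xy].
  have /set2P Da : a \in [set x; y] by rewrite E set21.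
  have /set2P Db : b \in [set x; y] by rewrite E set22.
  by case: Da Db ab => -> [] ->; rewrite ?sedge_irr // sedge_sym.
by exists x; apply/existsP; exists y; rewrite xy eqxx.
Qed.

Lemma imset_set2 (V W : finType) (f : V -> W) (x y : V) :
  f @: [set x; y] = [set f x; f y].
Proof. by rewrite imsetU1 imset_set1. Qed.

(** Counting replaces the exchanged pair of edges; unlike the existential
definition, it is visibly invariant under injections of the edges and under
adding common edges. *)
Lemma unit_transformationE (G : sgraph) (T T' : sptree G) :
  unit_transformation T T' =
    (#|val T' :\: val T| == 1) && (#|val T :\: val T'| == 1).
Proof.
apply/exists_inP/andP => [[e /setDP[_ eT]]|].
  case/exists_inP=> f fT /eqP ->.
  have nef : e != f by apply: contraNneq eT => ->.
  split; apply/cards1P; [exists e | exists f]; apply/setP => g; rewrite !inE.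
    have [->|] := eqVneq g e; first by rewrite nef eT.
    by case: (g \in val T) => //=; rewrite andbF.
  have [->|] := eqVneq g f; first by rewrite fT.
  by case: (g \in val T); rewrite ?orbT ?andbF.
case=> /cards1P[e De] /cards1P[f Df].
have /setDP[eT' eT] : e \in val T' :\: val T by rewrite De set11.
have /setDP[fT _] : f \in val T :\: val T' by rewrite Df set11.
have /subsetP T'G := spanning_tree_sub (valP T').
exists e; first by rewrite in_setD eT T'G.
apply/exists_inP; exists f => //; apply/eqP/setP => g; rewrite !inE.
move/setP/(_ g): De; move/setP/(_ g): Df; rewrite !inE.
by move=> <- <-; case: (g \in val T); case: (g \in val T').
Qed.

(** The sets [K :|: p @: T] and [K :|: p @: T'] differ by the image of the
difference of [T] and [T'], so their difference has the same size. *)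
Lemma card_setD_extension (V W : finType) (p : V -> W) (K : {set W})
    (A B : {set V}) :
    injective p -> (forall x, p x \notin K) ->
  #|(K :|: p @: A) :\: (K :|: p @: B)| = #|A :\: B|.
Proof.
move=> p_inj pK; rewrite -(card_imset _ p_inj); congr #|pred_of_set _|.
apply/setP => y; rewrite !inE; apply/idP/imsetP => [|[x /setDP[xA xB] ->]].
  rewrite negb_or => /andP[/andP[/negbTE-> yB] /imsetP[x xA def_y]].
  by exists x => //; rewrite in_setD xA andbT -(mem_imset _ _ p_inj) -def_y.
by rewrite !mem_imset // (negbTE (pK x)) xA xB.
Qed.

Lemma mem_extension (V W : finType) (p : V -> W) (K : {set W}) (A : {set V}) x :
  injective p -> (forall x, p x \notin K) -> (p x \in K :|: p @: A) = (x \in A).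
Proof. by move=> p_inj pK; rewrite inE (negbTE (pK x)) mem_imset. Qed.

Section Extension.

Variables (G H : sgraph) (f : G -> H) (K : {set {set H}}).
Hypotheses (f_inj : injective f) (f_edge : forall x y, f x -- f y = x -- y).
Hypotheses (K_edges : K \subset edges H).
Hypotheses (fK : forall e : {set G}, f @: e \notin K).

Local Notation extend T := (K :|: [set f @: e | e : {set G} in T]).

Let imf_inj : injective (fun e : {set G} => f @: e).
Proof. exact: imset_inj. Qed.

Lemma tree_adj_extension (T : {set {set G}}) (x y : G) :
  tree_adj (extend T) (f x) (f y) = tree_adj T x y.
Proof. by rewrite /tree_adj -imset_set2 mem_extension. Qed.

Lemma extension_sub_edges (T : {set {set G}}) :
  (extend T \subset edges H) = (T \subset edges G).
Proof.
have f_edges (e : {set G}) : (f @: e \in edges H) = (e \in edges G).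
  apply/idP/idP => [fe | eG].
    have:= fe; rewrite inE => /existsP[a /existsP[b /andP[_ /eqP E]]].
    have /imsetP[x _ Da] : a \in f @: e by rewrite E set21.
    have /imsetP[y _ Db] : b \in f @: e by rewrite E set22.
    have De : e = [set x; y] by apply: imf_inj; rewrite imset_set2 -Da -Db.
    by move: fe; rewrite De imset_set2 !mem_edges2 f_edge.
  have:= eG; rewrite inE => /existsP[x /existsP[y /andP[_ /eqP De]]].
  by move: eG; rewrite De imset_set2 !mem_edges2 f_edge.
rewrite subUset K_edges /=.
apply/subsetP/subsetP => [sub e eT | sub _ /imsetP[e eT ->]].
  by rewrite -f_edges sub // mem_imset.
by rewrite f_edges sub.
Qed.

(** Every spanning tree of [H] is obtained from one of [G]: it contains [K], and
its other edges come from [G].  The deletion of [K] is therefore inverse to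
the extension. *)
Lemma Aux_extension :
    (forall T : {set {set G}},
       connected_rel (tree_adj (extend T)) = connected_rel (tree_adj T)) ->
    (forall T : {set {set G}},
       acyclic_rel (tree_adj (extend T)) = acyclic_rel (tree_adj T)) ->
    (forall S : {set {set H}}, spanning_tree S -> K \subset S) ->
    (forall a b : H, a -- b ->
       [set a; b] \in K \/ exists x y, a = f x /\ b = f y) ->
  sgraph_iso (Aux G) (Aux H).
Proof.
move=> ext_conn ext_acyc K_tree edgeP.
have ext_tree (T : {set {set G}}) : spanning_tree (extend T) = spanning_tree T.
  rewrite /spanning_tree extension_sub_edges -!/(tree_adj _).
  by rewrite ext_conn ext_acyc.
pose restrict (S : {set {set H}}) : {set {set G}} := [set e : {set G} | f @: e \in S].
have extK (T : {set {set G}}) : restrict (extend T) = T.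
  by apply/setP => e; rewrite inE mem_extension.
have restrictK S : spanning_tree S -> extend (restrict S) = S.
  move=> treeS; apply/setP => e; rewrite inE.
  apply/orP/idP => [[|/imsetP[e0 + ->]] | eS]; last 1 first.
  - have /subsetP/(_ e eS) := spanning_tree_sub treeS.
    rewrite inE => /existsP[a /existsP[b /andP[ab /eqP De]]].
    have [|[x [y [Da Db]]]] := edgeP _ _ ab; rewrite De; [by left | right].
    by apply/imsetP; exists [set x; y]; rewrite ?inE imset_set2 -Da -Db -?De.
  - by have /subsetP := K_tree S treeS; apply.
  by rewrite inE.
have ext_sptree (T : sptree G) : spanning_tree (extend (val T)).
  by rewrite ext_tree (valP T).
have restrict_sptree (S : sptree H) : spanning_tree (restrict (val S)).
  by rewrite -ext_tree restrictK (valP S).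
exists (fun T : Aux G => Sub _ (ext_sptree T) : sptree H).
  exists (fun S : Aux H => Sub _ (restrict_sptree S) : sptree G) => X.
    exact/val_inj/extK.
  exact/val_inj/restrictK/(valP X).
by move=> T T'; rewrite /= !unit_transformationE /= !card_setD_extension.
Qed.

End Extension.

(** * Isomorphisms and pendant edges *)

Lemma Aux_sgraph_iso (G H : sgraph) :
  sgraph_iso G H -> sgraph_iso (Aux G) (Aux H).
Proof.
case=> f [r fK rK] f_edge; have f_inj := can_inj fK.
have no_extra (e : {set G}) : f @: e \notin (set0 : {set {set H}}).
  by rewrite inE.
have adjE := tree_adj_extension f_inj no_extra.
apply: (Aux_extension f_inj f_edge (sub0set _) no_extra) => [T|T|S _|a b _].
- apply: (connected_rel_retract fK) => [x y | a b | a]; first by rewrite adjE.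
    by rewrite -{1}[a]rK -{1}[b]rK adjE; exact: connect1.
  by rewrite rK connect0.
- apply: (acyclic_rel_embed f_inj (adjE T)) => c _ _ _ a _.
  by rewrite -[a]rK codom_f.
- exact: sub0set.
by right; exists (r a), (r b); rewrite !rK.
Qed.

Lemma Aux_append_K2 (G : sgraph) (v : G) :
  sgraph_iso (Aux G) (Aux (append_K2 v)).
Proof.
pose H := append_K2 v; pose f : G -> H := Some.
pose K : {set {set H}} := [set [set (None : H); f v]].
pose extend (T : {set {set G}}) := K :|: [set f @: e | e : {set G} in T].
have f_inj : injective f by move=> x y [].
have None_notin (e : {set G}) : (None : H) \notin f @: e.
  by apply/negP => /imsetP[].
have K_edges : K \subset edges H by rewrite sub1set mem_edges2 /=.
have fK (e : {set G}) : f @: e \notin K.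
  by apply: contra (None_notin e); rewrite inE => /eqP ->; rewrite set21.
have adjE := tree_adj_extension f_inj fK.
have adjN T x : tree_adj (extend T) None (f x) = (x == v).
  rewrite /tree_adj !inE orbC; case: imsetP => [[e _ E] | _].
    by have := None_notin e; rewrite -E set21.
  apply/eqP/eqP => [/setP/(_ (f x)) | -> //].
  by rewrite !inE eqxx orbT /= => /esym/eqP/f_inj.
have adjN' T x : tree_adj (extend T) (f x) None = (x == v).
  by rewrite tree_adj_sym adjN.
(* [[set None; None]] is a singleton, whereas every edge has two ends. *)
have adjNN T : tree_adj (extend T) None None = false.
  rewrite /tree_adj !inE orbC; case: imsetP => [[e _ E] | _].
    by have := None_notin e; rewrite -E set21.
  by apply/negP => /eqP/setP/(_ (f v)); rewrite !inE eqxx orbT.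
apply: (Aux_extension f_inj _ K_edges fK) => // [T|T|S treeS|a b].
- pose r (a : H) : G := if a is Some x then x else v.
  apply: (connected_rel_retract (f := f) (r := r)) => // [x y | [x|] [y|] | [x|]] /=.
  + by rewrite adjE.
  + by rewrite (adjE T x y); exact: connect1.
  + by rewrite (adjN' T x) => /eqP ->.
  + by rewrite (adjN T y) => /eqP ->.
  + by rewrite connect0.
  + by rewrite connect0.
  by apply/andP; split; apply: connect1; rewrite ?(adjN T v) ?(adjN' T v).
- apply: (acyclic_rel_embed f_inj (adjE T)) => c c2 Uc Cc.
  have Nc : (None : H) \notin c.
    apply: (pendant_notin_cycle (v := f v)) c2 Uc Cc => -[x|]; rewrite ?adjNN //.
      by rewrite (adjN T x) => /eqP ->.
    by rewrite (adjN' T x) => /eqP ->.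
  by move=> [x|] ca; [exact: codom_f | rewrite ca in Nc].
- (* The first edge of a path of [S] from [None] to [v] is the pendant edge. *)
  have SE := spanning_tree_sub treeS.
  case/and3P: treeS => _ /forallP/(_ None)/forallP/(_ (f v)) /connectP[[|a p]] //=.
  case/andP=> NaS _ _; have := subsetP SE _ NaS; rewrite mem_edges2 sub1set.
  by case: a NaS => //= x NxS /eqP xv; rewrite -xv.
case: a b => [x|] [y|] //=; first by right; exists x, y.
  by move/eqP->; left; rewrite setUC set11.
by move/eqP->; left; rewrite set11.
Qed.

Theorem lemma5 (G G' : sgraph) (hG : connected G) (hG' : iter_append_K2 G G') :
  sgraph_iso (Aux G') (Aux G).
Proof.
elim: hG' => {G'} [G' /Aux_sgraph_iso // | H G' v _ IH /Aux_sgraph_iso isoG'].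
apply: sgraph_iso_trans isoG' (sgraph_iso_trans _ IH).
exact/sgraph_iso_sym/Aux_append_K2.
Qed.
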